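(* Let $G$ be a finite group. Then $\mathcal{I}(G)=\zeta(\mathbb{Z}[G])$ if and only if $G$ is abelian.
   Context: For a noetherian integrally closed domain $\mathcal{O}$ with fraction field $F$ and an $\mathcal{O}$-order $\Lambda$ in a finite dimensional separable $F$-algebra $A$, the integrality ring $\mathcal{I}(\Lambda)$ is the $\zeta(\Lambda)$-submodule of $\zeta(A)$ generated by the reduced norms $\mathrm{nr}(H)$ of all matrices $H\in M_n(\Lambda)$, $n\in\mathbb{N}$. $\mathcal{I}(G):=\mathcal{I}(\mathbb{Z}[G])$ (with $A=\mathbb{Q}[G]$); $\zeta(\cdot)$ denotes the centre. *)

(* Defs.v *)
From HB Require Import structures.
From mathcomp Require Import all_boot all_order all_algebra all_fingroup all_solvable all_field all_character.
Set Implicit Arguments. Unset Strict Implicit. Unset Printing Implicit Defensive.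
Import Order.TTheory GRing.Theory Num.Theory.
Local Open Scope ring_scope.

(* The group ring of a finite group gT (G = [set: gT]) with coefficients in
   algC, elements being functions gT -> algC.  Z[G] subset Q[G] subset algC[G]. *)
Definition grpring (gT : finGroupType) := {ffun gT -> algC}.

Definition gr_mul (gT : finGroupType) (a b : grpring gT) : grpring gT :=
  [ffun x => \sum_(y : gT) a y * b (y^-1 * x)%g].

Definition gr_add (gT : finGroupType) (a b : grpring gT) : grpring gT :=
  [ffun x => a x + b x].

Definition gr_zero (gT : finGroupType) : grpring gT := [ffun _ => 0].

Definition in_ZG (gT : finGroupType) (a : grpring gT) : Prop :=
  forall x, a x \in Num.int.

Definition in_center_ZG (gT : finGroupType) (a : grpring gT) : Prop :=
  in_ZG a /\ forall b, in_ZG b -> gr_mul a b = gr_mul b a.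

(* Extension to n x n matrices over the group ring of the irreducible
   complex representation 'Chi_i of G = [set: gT]:
   H |-> (sum_g H_jk(g) Chi_i(g))_{j,k}, a (n * chi_i(1)) square complex matrix
   (indexed by pairs (j, a)). *)
Definition irr_deg (gT : finGroupType) (i : Iirr [set: gT]) : nat :=
  irr_degree (socle_of_Iirr i).

Definition rep_mat (gT : finGroupType) (i : Iirr [set: gT]) (n : nat)
    (H : 'M[grpring gT]_n) :
    'M[algC]_(#|{: 'I_n * 'I_(irr_deg i)}|) :=
  \matrix_(p, q)
    let: (j, a) := enum_val p in let: (k, b) := enum_val q in
    \sum_(g : gT) H j k g * ('Chi_i g) a b.

Definition cent_idem (gT : finGroupType) (i : Iirr [set: gT]) : grpring gT :=
  [ffun x => 'chi_i 1%g / #|[set: gT]|%:R * 'chi_i (x^-1)%g].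

(* reduced norm of H in M_n(Q[G]): the element of zeta(algC[G]) =
   prod_i algC e_i corresponding to the family (det Chi_i(H))_i under the
   Wedderburn isomorphism algC[G] = prod_i M_{chi_i(1)}(algC). *)
Definition rnorm (gT : finGroupType) (n : nat) (H : 'M[grpring gT]_n) :
    grpring gT :=
  [ffun x => \sum_(i : Iirr [set: gT]) \det (rep_mat i H) * cent_idem i x].

(* membership in the integrality ring I(G) = I(Z[G]): the zeta(Z[G])-submodule
   of zeta(Q[G]) generated by all nr(H), H in M_n(Z[G]), n in N, i.e. finite
   zeta(Z[G])-linear combinations of such reduced norms. *)
Definition in_integrality_ring (gT : finGroupType) (a : grpring gT) : Prop :=
  exists (m : nat) (z : 'I_m -> grpring gT) (ns : 'I_m -> nat)
         (H : forall k : 'I_m, 'M[grpring gT]_(ns k)),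
    (forall k, in_center_ZG (z k)) /\
    (forall k j l, in_ZG (H k j l)) /\
    a = \big[@gr_add gT/gr_zero gT]_(k < m) gr_mul (z k) (rnorm (H k)).

(* Main.v *)
Require Import Defs.
From mathcomp Require Import all_boot all_order all_algebra all_fingroup all_solvable all_field all_character.

Set Implicit Arguments.
Unset Strict Implicit.
Unset Printing Implicit Defensive.
Import Order.TTheory GRing.Theory Num.Theory.
Local Open Scope ring_scope.

(** If G is abelian, the reduced norm is the determinant over the commutative
    ring Z[G], so it takes values in Z[G].

    Conversely suppose that all reduced norms lie in Z[G].  Let K be a subgroup
    of order prime to p, with normal closure N.  The element c * \sum_(k in K) k
    is singular in 'Chi_i unless K is contained in the kernel, where it is the
    scalar c|K|.  Choosing c with c|K| = 1 modulo the p-part of |G|, integrality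
    of the coefficient of 1 says that |G|_p divides |G : N|, i.e. p does not
    divide |N|.  Applied to Sylow subgroups this shows that G is nilpotent.
    Finally the reduced norm of a group element g has integral coefficients
    whose squares sum to 1, so it is a central element of G; comparing values of
    linear characters gives G = Z(G)G', and a nilpotent G with this property
    is abelian. *)

(** * Auxiliary facts on determinants and nilpotent groups *)

Lemma det_mxsub_bij (R : comPzRingType) (m n : nat) (f : 'I_m -> 'I_n)
    (M : 'M[R]_n) : bijective f -> \det (mxsub f f M) = \det M.
Proof.
move=> bij_f; have eq_mn : m = n.
  by have := bij_eq_card bij_f; rewrite !card_ord.
move: f bij_f; rewrite eq_mn {m eq_mn} => f /bij_inj inj_f.
(* The same permutation acts on rows and columns, so its sign enters twice and cancels. *)
have ->: mxsub f f M = row_perm (perm inj_f) (col_perm (perm inj_f) M).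
  by apply/matrixP=> i j; rewrite !mxE !permE.
rewrite row_permE col_permE !det_mulmx !det_perm odd_permV mulrCA.
by rewrite -expr2 sqrr_sign mulr1.
Qed.

(** A normal Sylow subgroup is a [p]-core, hence lies in the Fitting subgroup; so each [p]-part of
    the order of [G] divides the order of ['F(G)]. *)
Lemma nilpotent_normal_Sylow (gT : finGroupType) (G : {group gT}) :
    (forall (p : nat) (P : {group gT}), p.-Sylow(G)%g P -> (P <| G)%g) ->
  nilpotent G.
Proof.
move=> nSyl; suff <-: 'F(G)%g = G by apply: Fitting_nil.
apply/eqP; rewrite eqEcard Fitting_sub dvdn_leq //.
apply/dvdn_partP=> // p _; have [P sylP] := Sylow_exists p G.
rewrite -(card_Hall sylP) -(normal_Hall_pcore sylP (nSyl p P sylP)).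
by rewrite -p_core_Fitting cardSg ?pcore_sub.
Qed.

Lemma det_trace1 (R : comPzRingType) (n : nat) (M : 'M[R]_n) :
  n = 1%N -> \det M = \tr M.
Proof.
move=> n1; move: M; rewrite n1 => M.
by rewrite det_mx11 [M]mx11_scalar mxtrace_scalar mxE.
Qed.

(** * Group ring elements and their reduced norms *)

Section GroupRing.

Variable gT : finGroupType.
Local Notation G := [set: gT].
Implicit Types (a b : grpring gT) (i : Iirr G).

Definition gr_elt (g : gT) : grpring gT := [ffun x => (x == g)%:R].

Definition gr_eval i a : algC := \sum_g a g * 'chi_i g.

Definition gr_rep i a : 'M[algC]_(irr_deg i) := \sum_g a g *: 'Chi_i g.

Lemma gr_eltZ g : in_ZG (gr_elt g).
Proof. by move=> x; rewrite ffunE natr_int. Qed.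

Lemma gr_addZ a b : in_ZG a -> in_ZG b -> in_ZG (gr_add a b).
Proof. by move=> Za Zb x; rewrite ffunE rpredD. Qed.

Lemma gr_mulZ a b : in_ZG a -> in_ZG b -> in_ZG (gr_mul a b).
Proof.
by move=> Za Zb x; rewrite ffunE; apply: rpred_sum => y _; rewrite rpredM.
Qed.

Lemma sum_gr_elt (V : lmodType algC) g (F : gT -> V) :
  \sum_x gr_elt g x *: F x = F g.
Proof.
rewrite (bigD1 g) //= ffunE eqxx scale1r big1 ?addr0 // => x /negPf neq_xg.
by rewrite ffunE neq_xg scale0r.
Qed.

Lemma gr_mul1r a : gr_mul (gr_elt 1) a = a.
Proof.
apply/ffunP=> x; rewrite ffunE.
by rewrite (sum_gr_elt 1 (fun y => a (y^-1 * x)%g : algC^o)) invg1 mul1g.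
Qed.

Lemma gr_mulr1 a : gr_mul a (gr_elt 1) = a.
Proof.
apply/ffunP=> x; rewrite ffunE (bigD1 x) //= ffunE mulVg eqxx mulr1.
rewrite big1 ?addr0 // => y neq_yx; rewrite ffunE.
by rewrite -eq_mulVg1 (negPf neq_yx) mulr0.
Qed.

Lemma gr_elt1_center : in_center_ZG (gr_elt 1).
Proof. by split=> [|b _]; [apply: gr_eltZ | rewrite gr_mul1r gr_mulr1]. Qed.

Lemma gr_add0 a : gr_add a (gr_zero gT) = a.
Proof. by apply/ffunP=> x; rewrite !ffunE addr0. Qed.

Lemma mul_center_integrality (n : nat) (z : grpring gT) (H : 'M[grpring gT]_n) :
    in_center_ZG z -> (forall j k, in_ZG (H j k)) ->
  in_integrality_ring (gr_mul z (rnorm H)).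
Proof.
move=> Zz ZH; exists 1, (fun=> z), (fun=> n), (fun=> H).
by do 2!split=> //; rewrite big_ord_recl big_ord0 gr_add0.
Qed.

Lemma rnorm_integrality (n : nat) (H : 'M[grpring gT]_n) :
  (forall j k, in_ZG (H j k)) -> in_integrality_ring (rnorm H).
Proof.
by rewrite -(gr_mul1r (rnorm H)); apply: mul_center_integrality gr_elt1_center.
Qed.

Lemma rnormE (n : nat) (H : 'M[grpring gT]_n) x :
  rnorm H x
  = \sum_i \det (rep_mat i H) * ('chi_i 1%g / #|G|%:R) * 'chi_i (x^-1)%g.
Proof. by rewrite ffunE; apply: eq_bigr => i _; rewrite ffunE mulrA. Qed.

Lemma det_rep_mat1 i a :
  \det (rep_mat i (const_mx a : 'M_1)) = \det (gr_rep i a).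
Proof.
pose f (p : 'I_#|{: 'I_1 * 'I_(irr_deg i)}|) := (enum_val p).2.
have bij_f: bijective f.
  exists (fun c => enum_rank (ord0, c)) => [p | c]; last first.
    by rewrite /f enum_rankK.
  rewrite /f -[RHS]enum_valK; case: (enum_val p) => j b /=.
  by rewrite (ord1 j).
rewrite -(det_mxsub_bij (gr_rep i a) bij_f); congr (\det _).
apply/matrixP=> p q; rewrite !mxE /f.
case: (enum_val p) (enum_val q) => [j b] [k c] /=.
by rewrite summxE; apply: eq_bigr => g _; rewrite !mxE.
Qed.

Lemma rnorm1E a x :
  rnorm (const_mx a : 'M_1) x
  = \sum_i \det (gr_rep i a) * ('chi_i 1%g / #|G|%:R) * 'chi_i (x^-1)%g.
Proof. by rewrite rnormE; under eq_bigr do rewrite det_rep_mat1. Qed.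

(** Empty determinants are 1, so the norm is the sum of all central idempotents. This exhibits the
    unit as a reduced norm. *)
Lemma rnorm0E (H : 'M[grpring gT]_0) : rnorm H = gr_elt 1.
Proof.
apply/ffunP=> x; rewrite rnormE ffunE.
transitivity (#|G|%:R^-1 * \sum_i 'chi_i 1%g * ('chi[G]_i x)^*).
  rewrite mulr_sumr; apply: eq_bigr => i _.
  rewrite char_inv ?irr_char //; set M := rep_mat i H.
  suff ->: \det M = 1 by rewrite mul1r mulrAC mulrC.
  have card0 : #|{: 'I_0 * 'I_(irr_deg i)}| = 0 by rewrite card_prod card_ord.
  by move: M; rewrite card0 => M; apply: det_mx00.
rewrite second_orthogonality_relation ?inE //.
rewrite class_sym class1G inE; case: eqP => [_|]; last by rewrite mulr0.
by rewrite mulr1n cent11T setIT mulVf // neq0CG.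
Qed.

(** The image of Z[G] in the product of copies of [algC] indexed by [Iirr G]. For abelian [G] it is
    a subring, so determinants of matrices over it stay in it. *)
Definition integral_family (v : Iirr G -> algC) : Prop :=
  exists2 a : grpring gT, in_ZG a & forall i, v i = gr_eval i a.

Lemma eq_integral_family v w :
  v =1 w -> integral_family v -> integral_family w.
Proof. by move=> eq_vw [a Za va]; exists a => // i; rewrite -eq_vw. Qed.

Lemma integral_familyD v w :
  integral_family v -> integral_family w ->
  integral_family (fun i => v i + w i).
Proof.
move=> [a Za va] [b Zb wb]; exists (gr_add a b); first exact: gr_addZ.
move=> i; rewrite va wb /gr_eval -big_split; apply: eq_bigr => g _ /=.
by rewrite ffunE mulrDl.
Qed.

Lemma integral_family_intr (c : algC) :
  c \in Num.int -> integral_family (fun i => c * 'chi_i 1%g).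
Proof.
move=> Zc; exists [ffun x => c * gr_elt 1%g x] => [x|i].
  by rewrite ffunE rpredM // gr_eltZ.
rewrite -(sum_gr_elt 1 (fun x => 'chi_i x : algC^o)) mulr_sumr.
by apply: eq_bigr => g _; rewrite !ffunE -mulrA.
Qed.

Lemma integral_family_sum (I : Type) (r : seq I) (v : I -> Iirr G -> algC) :
    (forall k, integral_family (v k)) ->
  integral_family (fun i => \sum_(k <- r) v k i).
Proof.
move=> intv; elim: r => [|k r IHr].
  apply: (eq_integral_family _ (integral_family_intr (rpred0 _))) => i.
  by rewrite big_nil mul0r.
apply: (eq_integral_family _ (integral_familyD (intv k) IHr)) => i.
by rewrite big_cons.
Qed.

(** * Abelian groups: the centre and the integrality ring are both Z[G] *)

Section Abelian.

Hypothesis cGG : abelian G.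

Lemma gr_mulC a b : gr_mul a b = gr_mul b a.
Proof.
apply/ffunP=> x; rewrite !ffunE.
rewrite (reindex_inj (inj_comp (mulgI x) invg_inj)) /=.
apply: eq_bigr => y _.
have comm_xy : commute x y by apply: (centsP cGG); rewrite inE.
by rewrite invMg invgK mulgKV mulrC (commuteV comm_xy).
Qed.

Lemma in_center_abelian a : in_center_ZG a <-> in_ZG a.
Proof. by split=> [[]//|Za]; split=> // b _; apply: gr_mulC. Qed.

Lemma irr1_abelian i : 'chi_i 1%g = 1.
Proof. exact: lin_char1 (char_abelianP _ cGG i). Qed.

Lemma gr_evalM i a b : gr_eval i (gr_mul a b) = gr_eval i a * gr_eval i b.
Proof.
have linX := char_abelianP _ cGG i.
rewrite /gr_eval mulr_suml.
transitivity (\sum_x \sum_y a y * b (y^-1 * x)%g * 'chi_i x).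
  by apply: eq_bigr => x _; rewrite ffunE mulr_suml.
rewrite exchange_big; apply: eq_bigr => y _ /=.
rewrite (reindex_inj (mulgI y)) mulr_sumr; apply: eq_bigr => x _ /=.
by rewrite mulKg lin_charM ?inE // mulrACA.
Qed.

Lemma integral_familyM v w :
  integral_family v -> integral_family w ->
  integral_family (fun i => v i * w i).
Proof.
move=> [a Za va] [b Zb wb]; exists (gr_mul a b); first exact: gr_mulZ.
by move=> i; rewrite va wb gr_evalM.
Qed.

Lemma integral_family_prod (I : Type) (r : seq I) (v : I -> Iirr G -> algC) :
    (forall k, integral_family (v k)) ->
  integral_family (fun i => \prod_(k <- r) v k i).
Proof.
move=> intv; elim: r => [|k r IHr].
  apply: (eq_integral_family _ (integral_family_intr (rpred1 _))) => i.
  by rewrite big_nil mul1r irr1_abelian.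
apply: (eq_integral_family _ (integral_familyM (intv k) IHr)) => i.
by rewrite big_cons.
Qed.

Lemma integral_family_det (n : nat) (M : Iirr G -> 'M[algC]_n) :
    (forall j k, integral_family (fun i => M i j k)) ->
  integral_family (fun i => \det (M i)).
Proof.
(* Leibniz expansion: a sum over permutations of a sign times a product of entries. *)
move=> intM; apply: integral_family_sum => s; apply: integral_familyM.
  have Zs: ((-1) ^+ s : algC) \in Num.int by rewrite rpredX ?rpredN1.
  apply: eq_integral_family (integral_family_intr Zs) => i.
  by rewrite irr1_abelian mulr1.
exact: integral_family_prod.
Qed.

(** Irreducible representations have degree one, so a pair index reduces to its first component and
    each block to a character value. *)
Lemma det_rep_mat_abelian (n : nat) (H : 'M[grpring gT]_n) i :
  \det (rep_mat i H) = \det (\matrix_(j, k) gr_eval i (H j k)).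
Proof.
pose f (p : 'I_#|{: 'I_n * 'I_(irr_deg i)}|) := (enum_val p).1.
have deg1 : irr_deg i = 1%N.
  by apply/eqP; rewrite -eqC_nat -irr1_degree irr1_abelian.
have eq_ord (b c : 'I_(irr_deg i)) : b = c.
  by move: b c; rewrite deg1 => b c; rewrite (ord1 b) (ord1 c).
have bij_f: bijective f.
  have b0 : 'I_(irr_deg i) by rewrite deg1; apply: ord0.
  exists (fun j => enum_rank (j, b0)) => [p | j]; last first.
    by rewrite /f enum_rankK.
  rewrite /f -[RHS]enum_valK; case: (enum_val p) => j b /=.
  by rewrite (eq_ord b b0).
rewrite -(det_mxsub_bij _ bij_f); congr (\det _).
apply/matrixP=> p q; rewrite !mxE /f.
case: (enum_val p) (enum_val q) => [j b] [k c] /=.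
apply: eq_bigr => g _; rewrite -irrRepr cfunE inE mulr1n /mxtrace.
congr (_ * _); rewrite (bigD1 b) //= big1 ?addr0.
  by rewrite (eq_ord c b).
by move=> d; rewrite (eq_ord d b) eqxx.
Qed.

Lemma rnormZ_abelian (n : nat) (H : 'M[grpring gT]_n) :
  (forall j k, in_ZG (H j k)) -> in_ZG (rnorm H).
Proof.
move=> ZH; pose M i := \matrix_(j, k) gr_eval i (H j k).
have [j k|a Za detM x] := @integral_family_det n M.
  exists (H j k) => // i; exact: mxE.
suff ->: rnorm H x = a x by [].
rewrite rnormE.
(* Fourier inversion: column orthogonality recovers the coefficient [a x] from the character values
   of [a]. *)
transitivity (\sum_i \sum_g a g / #|G|%:R * ('chi_i g * ('chi[G]_i x)^*)).
  apply: eq_bigr => i _; rewrite det_rep_mat_abelian detM irr1_abelian.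
  rewrite char_inv ?irr_char // mul1r !mulr_suml; apply: eq_bigr => g _.
  by rewrite -!mulrA; congr (_ * _); rewrite mulrCA.
rewrite exchange_big (bigD1 x) //= [X in _ + X]big1 => [|g neq_gx].
  rewrite -mulr_sumr second_orthogonality_relation ?inE // class_refl.
  have ->: ('C_G[x])%g = G.
    by apply/setIidPl/subsetP=> y _; apply/cent1P; apply: (centsP cGG);
       rewrite inE.
  by rewrite mulr1n addr0 divfK // neq0CG.
rewrite -mulr_sumr second_orthogonality_relation ?inE //.
by rewrite ((abelian_classP _ cGG) x) ?inE // (negPf neq_gx) mulr0.
Qed.

Lemma integrality_ring_abelian a : in_integrality_ring a <-> in_center_ZG a.
Proof.
split=> [[m [z [ns [H [Zz [ZH ->]]]]]] | Za].
  apply/in_center_abelian; elim/big_ind: _ => [x|b c|k _].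
  - by rewrite ffunE rpred0.
  - exact: gr_addZ.
  - by apply: gr_mulZ; [case: (Zz k) | apply: rnormZ_abelian].
(* The matrix [const_mx a] has size 0 here, so its entries are irrelevant and its norm is the
   unit. *)
rewrite -(gr_mulr1 a) -(rnorm0E (const_mx a)).
by apply: mul_center_integrality => // -[].
Qed.

End Abelian.

(** * Integral reduced norms force commutativity *)

Section IntegralNorms.

Hypothesis rnormZ : forall a, in_ZG a -> in_ZG (rnorm (const_mx a : 'M_1)).

Lemma cfker_irr_rker i : cfker 'chi_i = rker 'Chi_i.
Proof. by rewrite -irrRepr cfker_repr. Qed.

Definition gr_sum (c : nat) (K : {set gT}) : grpring gT :=
  [ffun x => c%:R * (x \in K)%:R].

Lemma gr_rep_sum i c (K : {set gT}) :
  gr_rep i (gr_sum c K) = c%:R *: \sum_(g in K) 'Chi_i g.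
Proof.
rewrite /gr_rep [X in _ *: X]big_mkcond scaler_sumr; apply: eq_bigr => g _.
by rewrite ffunE; case: ifP; rewrite ?mulr1 ?mulr0 ?scale0r ?scaler0.
Qed.

(* For h in K, 'Chi_i h fixes the image S of the sum of K under left
   multiplication, so 'Chi_i h = 1 as soon as S is invertible. *)
Lemma det_gr_rep_sum i c (K : {group gT}) :
  \det (gr_rep i (gr_sum c K))
  = if K \subset cfker 'chi_i then (c * #|K|)%:R ^+ irr_deg i else 0.
Proof.
rewrite gr_rep_sum cfker_irr_rker; case: ifPn => [sKker | /subsetPn[h Kh]].
  rewrite (eq_bigr (fun=> 1%:M)); last first.
    by move=> g /(subsetP sKker)/rkerP[].
  by rewrite sumr_const -scaler_nat scalerA -natrM scalemx1 det_scalar.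
apply: contraNeq => nz_det; apply/rkerP; split; first by rewrite inE.
set S := \sum_(g in K) 'Chi_i g in nz_det *.
have uS : c%:R *: S \in unitmx by rewrite unitmxE unitfE.
apply: (can_inj (mulmxK uS)); rewrite mul1mx -scalemxAr; congr (_ *: _).
rewrite mulmx_sumr [RHS](reindex_inj (mulgI h)) /=.
apply: eq_big => [g | g Kg]; first by rewrite groupMl.
by rewrite repr_mxM ?inE.
Qed.

Lemma normal_closure_p'group (p : nat) (K : {group gT}) :
  prime p -> (p^'.-group K -> p^'.-group <<class_support K G>>)%g.
Proof.
move=> p_pr p'K; pose N := <<class_support K G>>%G; rewrite -/(gval N); pose q := (#|G|`_p)%N.
have coKq : coprime #|K| q.
  by rewrite coprime_sym (pnat_coprime (part_pnat _ _)).
have nsNG : (N <| G)%g.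
  rewrite /normal subsetT; apply: subset_trans (norm_gen _).
  exact: class_support_norm.
(* Kernels are normal, so they contain [K] exactly when they contain its normal closure. *)
have sKN i : (K \subset cfker 'chi_i) = (N \subset cfker 'chi_i).
  rewrite gen_subG; apply/idP/idP => [sK | ].
    exact: class_support_sub_norm sK (normal_norm (cfker_normal _)).
  exact: subset_trans (sub_class_support _ _).
have q_gt0 : (0 < q)%N by rewrite part_gt0.
(* By Euler's theorem, [c] inverts the order of [K] modulo [q]. *)
pose c := (#|K| ^ (totient q).-1)%N; pose m := (c * #|K|)%N.
have m1 : m = 1 %[mod q].
  by rewrite /m /c -expnSr prednK ?totient_gt0 // Euler_exp_totient.
(* [S m] is the order of [G] times the coefficient of 1 in the norm; [S 1] is the sum of squared
   degrees for the quotient by [N]. *)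
pose S (e : nat) := (\sum_(i | N \subset cfker 'chi[G]_i)
  e ^ irr_deg i * irr_deg i ^ 2)%N.
have S1 : S 1%N = #|G : N|%g.
  apply/eqP; rewrite -eqC_nat -card_quotient ?normal_norm //.
  rewrite -irr_sum_square natr_sum.
  have nrm (H : {group coset_of N}) (j : Iirr H) :
    'chi_j 1%g ^+ 2 = `|'chi_j 1%g| ^+ 2 by rewrite irr1_degree normr_nat.
  under [X in _ == X]eq_bigr do rewrite nrm.
  rewrite -[1%g in X in _ == X](coset_id (group1 N)).
  rewrite sum_norm_irr_quo ?inE //; apply/eqP/eq_bigr => i _.
  by rewrite exp1n mul1n irr1_degree normr_nat natrX.
have dvdS : (#|G| %| S m)%N.
  have Za : in_ZG (gr_sum c K) by move=> x; rewrite ffunE rpredM ?natr_int.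
  have := rnormZ Za 1%g; rewrite rnorm1E => intS.
  rewrite -dvdC_nat; apply/dvdCP; eexists; first exact: intS.
  rewrite -[LHS]/((S m)%:R) natr_sum mulr_suml [LHS]big_mkcond; apply: eq_bigr => i _.
  rewrite det_gr_rep_sum sKN invg1; case: ifP => _; last by rewrite !mul0r.
  rewrite irr1_degree natrM !natrX -!mulrA; congr (_ * _).
  by rewrite [_ * #|_|%:R]mulrC mulKf ?neq0CG // expr2.
have dvdq : (q %| #|G : N|%g)%N.
  rewrite -S1 /dvdn; suff <-: (S m = S 1 %[mod q])%N.
    exact: dvdn_trans (dvdn_part _ _) dvdS.
  rewrite /S; elim/big_rec2: _ => // i x y _ eq_xy.
  rewrite -modnDm eq_xy modnDm; apply/eqP; rewrite eqn_modDr; apply/eqP.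
  by rewrite -modnMml -modnXm m1 modnXm modnMml.
(* If [p] divided the order of [N], then [p * q] would divide that of [G], although [q] is its full
   [p]-part. *)
rewrite /pgroup p'natE //; apply/negP => dvdpN.
have: (p * q %| #|G|)%N by rewrite -(Lagrange (subsetT N)) dvdn_mul.
by rewrite /q p_part -expnS pfactor_dvdn // ltnn.
Qed.

(** For each prime [r] other than [p], the normal closure of a Sylow [p]-subgroup has order prime to
    [r]. It is thus a [p]-group, equal to the Sylow subgroup by maximality. *)
Lemma nilpotent_integral : nilpotent G.
Proof.
apply: nilpotent_normal_Sylow => p P sylP.
have [p_pr | p_npr] := boolP (prime p); last first.
  (* For [p] not prime the [p]-part is 1 by convention. *)
  have /eqP-> : P :==: 1%g; last exact: normal1.
  rewrite trivg_card1 (card_Hall sylP) p_part lognE.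
  by rewrite (negPf p_npr).
pose N := <<class_support P G>>%G.
have sPN : P \subset N.
  exact: subset_trans (sub_class_support _ _) (subset_gen _).
have pN : (p.-group N)%g.
  apply/pgroupP=> r r_pr rN; rewrite inE; apply/negP => neq_rp.
  have/(normal_closure_p'group r_pr) : (r^'.-group P)%g.
    apply: pi_pnat (pHall_pgroup sylP) _; rewrite !inE eq_sym.
    exact/negP.
  by rewrite /pgroup p'natE // rN.
suff ->: P :=: N.
  rewrite /normal subsetT; apply: subset_trans (norm_gen _).
  exact: class_support_norm.
by rewrite (sub_pHall sylP pN sPN (subsetT N)).
Qed.

Lemma cent_der1_integral : G \subset ('Z(G) * G^`(1))%g.
Proof.
apply/subsetP=> g _; pose o : algC := #|G|%:R.
have nz_o : o != 0 by rewrite /o neq0CG.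
pose d i := \det ('Chi_i g).
(* [d i] is a root of unity, since [g] has finite order. *)
have d_norm i : `|d i| = 1.
  have detX n : \det ('Chi_i (g ^+ n)%g) = d i ^+ n.
    elim: n => [|n IHn]; first by rewrite repr_mx1 det1.
    by rewrite expgS repr_mxM ?inE // det_mulmx IHn exprS.
  have ord_d : d i ^+ #[g]%g = 1 by rewrite -detX expg_order repr_mx1 det1.
  by apply/eqP; rewrite -(@pexpr_eq1 _ _ #[g]%g) // -normrX ord_d normr1.
have d_lin i : 'chi_i \is a linear_char -> d i = 'chi_i g.
  move=> /lin_char1; rewrite irr1_degree => /(congr1 (@eq_op algC ^~ 1)).
  rewrite eqxx pnatr_eq1 => /eqP deg1.
  by rewrite -irrRepr cfunE inE mulr1n -det_trace1.
(* The norm of [g] read at inverses, which makes it a combination of irreducible characters. *)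
pose psi : 'CF(G) := \sum_i (d i * ('chi_i 1%g / o)) *: 'chi_i.
have psiZ y : psi y \in Num.int.
  suff ->: psi y = rnorm (const_mx (gr_elt g) : 'M_1) (y^-1)%g.
    exact: rnormZ (gr_eltZ g) _.
  rewrite rnorm1E invgK sum_cfunE; apply: eq_bigr => i _.
  by rewrite cfunE /gr_rep sum_gr_elt.
have dot_psi i : '[psi, 'chi_i] = d i * ('chi_i 1%g / o).
  rewrite cfdot_suml (bigD1 i) //= cfdotZl cfdot_irr eqxx mulr1.
  rewrite big1 ?addr0 // => j /negPf neq_ji.
  by rewrite cfdotZl cfdot_irr neq_ji mulr0.
have dot_sum (phi : 'CF(G)) :
    o * '[psi, phi] = \sum_y psi y * (phi y)^*.
  rewrite cfdotE mulVKf //; by apply: eq_bigl => y; rewrite inE.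
have norm_psi : \sum_y psi y ^+ 2 = 1.
  transitivity (o * '[psi]).
    by rewrite dot_sum; apply: eq_bigr => y _; rewrite -normCK intr_normK.
  rewrite cfdot_sum_irr.
  transitivity (o * \sum_i ('chi[G]_i 1%g ^+ 2 / o ^+ 2)).
    congr (_ * _); apply: eq_bigr => i _.
    rewrite dot_psi -normCK !normrM d_norm mul1r exprMn normfV.
    by rewrite irr1_degree !normr_nat exprVn.
  by rewrite -mulr_suml irr_sum_square -/o expr2 invfM mulVKf ?mulfV.
have [y nz_y] : exists y, psi y != 0.
  apply/existsP; apply: contra_eqT norm_psi; rewrite negb_exists => /forallP z.
  rewrite big1 => [|y _]; first by rewrite eq_sym oner_eq0.
  by have:= z y; rewrite negbK => /eqP->; rewrite expr0n.
(* A second nonzero integer value would push the sum of squares to at least 2. *)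
have psi_y x : x != y -> psi x = 0.
  move=> neq_xy; apply: contra_eq norm_psi => nz_x.
  rewrite gt_eqF // (bigD1 y) //= (bigD1 x) //= addrA.
  rewrite ltr_wpDr ?sumr_ge0 // => [z _|]; last first.
    have/lt_le_trans->// : (1 : algC) < 1 + 1 by rewrite ltrDl ltr01.
    by rewrite lerD ?sqr_intr_ge1.
  by rewrite -intr_normK // exprn_ge0.
(* A class function supported at a single point forces that point to be central. *)
have Zy : y \in 'Z(G)%g.
  rewrite inE inE /=; apply/centP=> x Gx; apply/commgP/conjg_fixP.
  by apply: contraNeq nz_y => /psi_y; rewrite cfunJ // => ->.
have det_y i : d i * 'chi_i 1%g = psi y * ('chi_i y)^*.
  have := dot_sum 'chi_i; rewrite dot_psi mulrC mulrA divfK // => ->.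
  rewrite (bigD1 y) //= big1 ?addr0 // => x /psi_y->; exact: mul0r.
(* The trivial character fixes the sign. *)
have psi_y1 : psi y = 1.
  have lin0 : 'chi[G]_0 \is a linear_char by rewrite irr0 cfun1_lin_char.
  have := det_y 0; rewrite d_lin // irr0 !cfun1E !inE.
  by rewrite conjC1 !mulr1.
(* Every linear character sends [g] to the conjugate of its value at [y], so [y * g] lies in all
   their kernels. *)
have Gy: (y * g)%g \in G^`(1)%g.
  rewrite -cap_cfker_lin_irr; apply/bigcapP=> i lin_i.
  rewrite cfkerEirr inE lin_charM ?inE // lin_char1 //.
  have := det_y i; rewrite lin_char1 // mulr1 psi_y1 mul1r d_lin // => ->.
  by rewrite -normCK normC_lin_char ?inE // expr1n.
by rewrite -(mulKg y g) mem_mulg ?groupV.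
Qed.

(** The quotient by the centre is solvable and, by [cent_der1_integral], equal to its own derived
    subgroup; hence it is trivial. *)
Lemma abelian_integral : abelian G.
Proof.
have nilG := nilpotent_integral.
apply/center_idP/eqP; rewrite eqEsubset center_sub /=.
rewrite -quotient_sub1 ?normal_norm ?center_normal // subG1.
apply: contraT => ntQ.
have := sol_der1_proper (nilpotent_sol (quotient_nil _ nilG)) (subxx _) ntQ.
rewrite properE => /andP[_ /negP[]].
rewrite -quotient_der ?normal_norm ?center_normal //.
apply: subset_trans (quotientS _ cent_der1_integral) _.
by rewrite quotientMidl.
Qed.

End IntegralNorms.

End GroupRing.

Theorem theorem3p6 (gT : finGroupType) :
  (forall a : grpring gT, in_integrality_ring a <-> in_center_ZG a)
  <-> abelian [set: gT].
Proof.
split=> [eqI | cGG a]; last exact: integrality_ring_abelian.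
apply: abelian_integral => a Za; apply: (proj1 (proj1 (eqI _) _)).
by apply: rnorm_integrality => j k; rewrite mxE.
Qed.
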